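(* Let $k\ge1$, $n_0\ge0$ be integers, $0<\alpha\le1$, and let $\lambda_{(n)_i}>0$ ($n\ge n_0$, $1\le i\le k$). Let $p^{\alpha}(n,t)$, $n\ge n_0$, be the state probabilities of the generalized fractional birth process $\{\mathcal{X}^{\alpha}(t)\}_{t\ge0}$ with these rates, and let $\tilde p^{\alpha}(n,s)=\int_0^\infty e^{-st}p^{\alpha}(n,t)\,\mathrm{d}t$, $s>0$. Then $$\tilde p^{\alpha}(n_0,s)=\frac{s^{\alpha-1}}{s^{\alpha}+\sum_{i=1}^{k}\lambda_{(n_0)_i}},$$ and for every $m\ge1$ $$\tilde p^{\alpha}(n_0+m,s)=\begin{cases}\displaystyle\sum_{(x_1,\dots,x_m)\in\Theta_m^{k}}\frac{s^{\alpha-1}\prod_{j=0}^{m-1}\lambda_{(n_0+j)_{x_{j+1}}}}{\prod_{j\in\Lambda_m}\left(s^{\alpha}+\sum_{i=1}^{k}\lambda_{(n_0+j)_i}\right)}, & 1\le k\le m-1,\\[3ex]\displaystyle\sum_{(x_1,\dots,x_m)\in\Theta_m^{m}}\frac{s^{\alpha-1}\prod_{j=0}^{m-1}\lambda_{(n_0+j)_{x_{j+1}}}}{\prod_{j\in\Lambda_m}\left(s^{\alpha}+\sum_{i=1}^{k}\lambda_{(n_0+j)_i}\right)}, & k\ge m,\end{cases}$$ where $\lambda_{(n)_0}$ is interpreted as $1$ for all $n\ge n_0$.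
   Context: Caputo derivative: for $0<\alpha<1$, $\frac{\mathrm{d}^{\alpha}}{\mathrm{d}t^{\alpha}}f(t)=\frac{1}{\Gamma(1-\alpha)}\int_0^t(t-s)^{-\alpha}f'(s)\,\mathrm{d}s$; for $\alpha=1$ it is $f'(t)$. The generalized fractional birth process (GFBP) $\{\mathcal{X}^{\alpha}(t)\}_{t\ge0}$ is the process whose state probabilities $p^{\alpha}(n,t)=\mathrm{Pr}\{\mathcal{X}^{\alpha}(t)=n\}$ satisfy $$\frac{\mathrm{d}^{\alpha}}{\mathrm{d}t^{\alpha}}p^{\alpha}(n,t)=-\sum_{i=1}^{k}\lambda_{(n)_i}p^{\alpha}(n,t)+\sum_{i=1}^{\min\{n,k\}}\lambda_{(n-i)_i}p^{\alpha}(n-i,t),\quad n\ge n_0,$$ with $p^{\alpha}(n_0,0)=1$, $p^{\alpha}(n,0)=0$ for $n>n_0$, and $p^{\alpha}(n,t)=0$ for $n<n_0$. The sets $\Theta_n^k\subset\mathbb{R}^n$ ($n,k\ge1$): let $\bar e_n^{\,j}$ be the $n$-tuple unit row vector with $1$ at the $j$th place and $0$ elsewhere, and for $m>n$ let $Q_{n\times m}=[\,I_{n\times n}\ \ O_{n\times(m-n)}\,]$ (identity block followed by zero block), so that $\bar x\mapsto\bar xQ_{n\times m}$ appends $m-n$ zeros to $\bar x$. For a set $A$ of row vectors, $AQ+v=\{\bar xQ+v:\bar x\in A\}$. Then $\Theta_1^k=\{(1)\}$ for all $k\ge1$, and for $n\ge2$ $$\Theta_n^k=\begin{cases}\bigcup_{i=1}^{k}\left\{\Theta_{n-i}^{k}Q_{(n-i)\times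 n}+i\,\bar e_n^{\,n-i+1}\right\}, & 1\le k\le n-1,\\[1ex]\bigcup_{i=1}^{n-1}\left\{\Theta_{n-i}^{n}Q_{(n-i)\times n}+i\,\bar e_n^{\,n-i+1}\right\}\cup\{n\,\bar e_n^{\,1}\}, & k\ge n.\end{cases}$$ For $(x_1,\dots,x_n)\in\Theta_n^k$, $\Lambda_n=\{0,1,\dots,n\}\setminus\{1\le j\le n-1:\ x_{j+1}=0\}$ (so $\Lambda_n$ depends on the tuple). *)

(* Defs.v *)
From HB Require Import structures.
From mathcomp Require Import all_boot all_order all_algebra.
From mathcomp Require Import zify.
From mathcomp Require Import all_classical all_reals all_analysis.

Set Implicit Arguments.
Unset Strict Implicit.
Unset Printing Implicit Defensive.

Import Order.TTheory GRing.Theory Num.Theory.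
Import numFieldNormedType.Exports.

Local Open Scope classical_set_scope.
Local Open Scope ring_scope.

Definition Gamma (R : realType) (z : R) : R :=
  \int[@lebesgue_measure R]_(t in `]0, +oo[) (t `^ (z - 1) * expR (- t)).

Definition caputo (R : realType) (alpha : R) (f : R -> R) (t : R) : R :=
  if alpha < 1 then
    (Gamma (1 - alpha))^-1 *
      \int[@lebesgue_measure R]_(s in `[0, t]) ((t - s) `^ (- alpha) * derive1 f s)
  else derive1 f t.

(* Extended-real valued: an equation [laplace f s = r%:E] also asserts that the
   integral converges. *)
Definition laplace (R : realType) (f : R -> R) (s : R) : \bar R :=
  (\int[@lebesgue_measure R]_(t in `[0%R, +oo[) (expR (- (s * t)) * f t)%:E)%E.

(* f belongs to AC[0, T] for every T, AC being taken, as is usual in fractional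
   calculus, to be the space of primitives of integrable functions. Then f' = g
   almost everywhere. *)
Definition abs_continuous (R : realType) (f : R -> R) : Prop :=
  exists g : R -> R,
    (forall T : R, 0 <= T ->
       (@lebesgue_measure R).-integrable `[0, T] (EFin \o g)) /\
    (forall t : R, 0 <= t ->
       f t = f 0 + \int[@lebesgue_measure R]_(u in `[0, t]) g u).

(* With rates growing fast enough in n the process may leave nat in finite
   time, i.e. its state probabilities may sum to less than 1; [None] is the
   state after such an explosion. Only times t >= 0 matter. *)
Definition state_prob (R : realType) (d : measure_display)
    (T : measurableType d) (P : probability T R) (X : R -> T -> option nat)
    (n : nat) (t : R) : R :=
  fine (P (X t @^-1` [set Some n])).

(* [lam n i] is the rate of a jump of size i from state n. The equations are
   required at t > 0: for alpha < 1 the Caputo derivative at t = 0 is an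
   integral over a null set, whereas their right-hand side need not vanish
   there. Absolute continuity is what gives the Caputo derivative a meaning:
   f' then exists a.e. and is locally integrable, even if, as for the
   Mittag-Leffler function, it is unbounded near 0. *)
Record is_GFBP (R : realType) (k n0 : nat) (alpha : R) (lam : nat -> nat -> R)
    (d : measure_display) (T : measurableType d) (P : probability T R)
    (X : R -> T -> option nat) : Prop := IsGFBP {
  GFBP_measurable : forall (t : R) (n : nat), 0 <= t ->
    measurable (X t @^-1` [set Some n]) ;
  GFBP_abs_continuous : forall n : nat, (n0 <= n)%N ->
    abs_continuous (state_prob P X n) ;
  GFBP_equation : forall (n : nat) (t : R), (n0 <= n)%N -> 0 < t ->
    caputo alpha (state_prob P X n) t =
      - (\sum_(1 <= i < k.+1) lam n i) * state_prob P X n t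
      + \sum_(1 <= i < (minn n k).+1)
          lam (n - i)%N i * state_prob P X (n - i)%N t ;
  GFBP_init : state_prob P X n0 0 = 1 ;
  GFBP_init_gt : forall n : nat, (n0 < n)%N -> state_prob P X n 0 = 0 ;
  GFBP_lt : forall (n : nat) (t : R), (n < n0)%N -> 0 <= t ->
    state_prob P X n t = 0
}.

(* Row vectors are indexed from 0 in the library: the j-th place of a tuple,
   j >= 1, is column j - 1. *)
Definition unit_row (n j : nat) : 'rV[nat]_n := \row_(l < n) (l.+1 == j : nat).

(* [pid_mx n] of size n x m is the block matrix [I O] when n <= m. *)
Definition Qmx (n m : nat) : 'M[nat]_(n, m) := pid_mx n.

(* Recursion on the dimension n; N only serves as a bound on n that decreases
   structurally. The defining equations are [Theta1], [Theta_low] and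
   [Theta_high] below. *)
Fixpoint Theta_rec (N k n : nat) : set 'rV[nat]_n :=
  if N is N'.+1 then
    if n == 1%N then [set const_mx 1%N]
    else if (k <= n - 1)%N then
      \bigcup_(i in [set i | (1 <= i <= k)%N])
        [set x *m Qmx (n - i)%N n + unit_row n (n - i + 1)%N *+ i
           | x in @Theta_rec N' k (n - i)%N]
    else
      (\bigcup_(i in [set i | (1 <= i <= n - 1)%N])
         [set x *m Qmx (n - i)%N n + unit_row n (n - i + 1)%N *+ i
            | x in @Theta_rec N' n (n - i)%N])
      `|` [set unit_row n 1 *+ n]
  else set0.

Arguments Theta_rec N k n : clear implicits.

Definition Theta (k n : nat) : set 'rV[nat]_n := Theta_rec n k n.

Arguments Theta k n : clear implicits.

Lemma Theta_rec_stable N N' k n : (0 < n <= N)%N -> (n <= N')%N ->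
  Theta_rec N k n = Theta_rec N' k n.
Proof.
elim: N N' k n => [|N IH] [|N'] k n /=; try by case: n.
move=> /andP[n0 nN] nN'; case: eqVneq => // n1.
case: ifPn => [kn|_].
  by apply: eq_bigcupr => i /= /andP[i1 ik]; rewrite (IH N') //; lia.
congr (_ `|` _).
by apply: eq_bigcupr => i /= /andP[i1 ik]; rewrite (IH N') //; lia.
Qed.

Lemma Theta1 k : Theta k 1 = [set const_mx 1%N].
Proof. by []. Qed.

Lemma Theta_low k n : (2 <= n)%N -> (1 <= k <= n - 1)%N ->
  Theta k n =
    \bigcup_(i in [set i | (1 <= i <= k)%N])
      [set x *m Qmx (n - i)%N n + unit_row n (n - i + 1)%N *+ i
         | x in Theta k (n - i)%N].
Proof.
case: n => // n n2 /andP[k1 kn]; rewrite {1}/Theta /= ifF; last by lia.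
rewrite kn; apply: eq_bigcupr => i /= /andP[i1 ik].
by rewrite (@Theta_rec_stable n (n.+1 - i)) //; lia.
Qed.

Lemma Theta_high k n : (2 <= n)%N -> (n <= k)%N ->
  Theta k n =
    (\bigcup_(i in [set i | (1 <= i <= n - 1)%N])
       [set x *m Qmx (n - i)%N n + unit_row n (n - i + 1)%N *+ i
          | x in Theta n (n - i)%N])
    `|` [set unit_row n 1 *+ n].
Proof.
case: n => // n n2 nk; rewrite {1}/Theta /= ifF; last by lia.
rewrite ifF; last by lia.
congr (_ `|` _); apply: eq_bigcupr => i /= /andP[i1 ik].
by rewrite (@Theta_rec_stable n (n.+1 - i)) //; lia.
Qed.

Lemma finite_Theta k n : finite_set (Theta k n).
Proof.
rewrite /Theta.
suff H N : finite_set (Theta_rec N k n) by exact: H.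
elim: N k n => [|N IH] k n /=.
  exact: finite_set0.
have fin a : finite_set [set i | (1 <= i <= a)%N].
  by apply: (sub_finite_set _ (finite_II a.+1)) => i /= /andP[_].
case: ifP => _; first exact: finite_set1.
case: ifP => _; last rewrite finite_setU; last split; last exact: finite_set1.
all: by apply: bigcup_finite => // i _; apply/finite_image/IH.
Qed.

(* Column j of x is x_{j+1}. *)
Definition Lambda (n : nat) (x : 'rV[nat]_n) : {set 'I_n.+1} :=
  [set: 'I_n.+1]
    :\: [set widen_ord (leqnSn n) j
           | j in [set j : 'I_n | (1 <= j <= n - 1)%N && (x ord0 j == 0%N)]].

Definition rate0 (R : realType) (lam : nat -> nat -> R) (n i : nat) : R :=
  if i == 0%N then 1 else lam n i.

Definition GFBP_term (R : realType) (k n0 : nat) (alpha : R)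
    (lam : nat -> nat -> R) (s : R) (m : nat) (x : 'rV[nat]_m) : R :=
  s `^ (alpha - 1) * (\prod_(j < m) rate0 lam (n0 + j)%N (x ord0 j))
  / \prod_(j in Lambda x) (s `^ alpha + \sum_(1 <= i < k.+1) lam (n0 + j)%N i).

(* Main.v *)
Require Import Defs.
From HB Require Import structures.
From mathcomp Require Import all_boot all_order all_algebra.
From mathcomp Require Import zify ring lra.
From mathcomp Require Import all_classical all_reals all_analysis.
From mathcomp Require Import measurable_realfun.

Set Implicit Arguments.
Unset Strict Implicit.
Unset Printing Implicit Defensive.

Import Order.TTheory GRing.Theory Num.Theory.
Import numFieldNormedType.Exports.

Local Open Scope classical_set_scope.
Local Open Scope ring_scope.

(** The state probabilities solve a triangular system of Caputo equations
    D^alpha p_n = h_n, where h_n is the linear combination of p_n and of the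
    earlier p_(n-i) on the right-hand side.  Taking Laplace transforms turns
    the system into a linear recursion, and the sets Theta enumerate the paths
    of jumps that appear when this recursion is unrolled.

    The analytic point is the rule
      L[D^alpha f](s) = s^alpha L[f](s) - s^(alpha-1) f(0)
    ([Rintegral_damped_caputo]).  The textbook proof transforms the convolution
    of t^(-alpha) and f' directly, which requires e^(-st) f'(t) to be integrable
    on the half-line; here f' is only locally integrable.  But f and h = D^alpha
    f are bounded.  For alpha < 1, Fubini on [0, T], where everything is
    integrable, gives
      Gamma(1-alpha) int_0^T h = int_0^T y^(-alpha) (f(T-y) - f(0)) dy
    ([Rintegral_caputo_lt1]): integrating the convolution of k and f' is the
    same as convolving k with the primitive of f'.  Derivatives have
    disappeared, and the Laplace transform in T of both sides is an absolutely
    convergent convolution; together with L[y^(-alpha)](s) = s^(alpha-1)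
    Gamma(1-alpha) this gives the rule after division by Gamma(1-alpha).  For
    alpha = 1 the starting identity is int_0^T h = f(T) - f(0).

    Hence, writing F_m for the transform of p_(n0+m) and L_n for the total rate
    of leaving n,
      (s^alpha + L_(n0+m)) F_m
        = s^(alpha-1) [m = 0] + sum_(1 <= i <= min(m,k)) lam_(n0+m-i, i) F_(m-i)
    ([laplace_state_prob_rec]).  On the combinatorial side, a sequence in
    Theta_m ends with a jump of some size i, and removing it leaves a sequence
    in Theta_(m-i), where Theta_0 must be read as the singleton of the empty
    sequence ([Theta_append]).  The last jump contributes to the summand the
    factor lam_(n0+m-i, i) / (s^alpha + L_(n0+m)) ([GFBP_term_append]), because
    the zero columns that follow it are exactly the indices that Lambda omits.
    So the sums over Theta satisfy the same recursion ([GFBP_sum_rec]), and the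
    two agree by strong induction on m. *)

(** * Integrals of almost everywhere equal functions *)

Section nonmeasurable.
Import HBNNSimple.

(** The integral of a nonnegative function is a supremum over the simple
    functions below it, and a simple function may be set to 0 on a null set
    without changing its integral.  So null sets are invisible to the integral
    even of nonmeasurable functions, among which the pointwise derivative of a
    function that is differentiable only almost everywhere may fall. *)
Lemma ae_eq_integral_nonmeasurable d (T : measurableType d) (R : realType)
    (mu : {measure set T -> \bar R}) (f g : T -> \bar R) : {ae mu, forall x, f x = g x} ->
  (\int[mu]_x f x = \int[mu]_x g x)%E.
Proof.
move=> [N [mN N0 fgN]].
have half (u v : T -> \bar R) : (forall x, ~ N x -> u x = v x) ->
  (forall x, (0 <= v x)%E) ->
  (ereal_sup [set sintegral mu h |
     h in [set h : {nnsfun T >-> R} | forall x, (h x)%:E <= u x]%E] <=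
   ereal_sup [set sintegral mu h |
     h in [set h : {nnsfun T >-> R} | forall x, (h x)%:E <= v x]%E])%E.
  move=> uv v0; apply: ge_ereal_sup => _ [h hu <-].
  have mNC := measurableC mN.
  apply: (ereal_sup_ubound); exists (proj_nnsfun h mNC).
    move=> x /=; rewrite mindicE.
    have [xN|xN] := pselect (N x).
      by rewrite memNset ?mulr0//=; apply.
    by rewrite mem_set// mulr1 -uv.
  rewrite -!integralT_nnsfun; apply: ae_eq_integral => //.
  - exact/measurable_EFinP.
  - exact/measurable_EFinP.
  exists N; split => // x; apply: contraPP => xN; apply; move=> _ /=.
  by rewrite mindicE mem_set// mulr1.
have {}half (u v : T -> \bar R) : (forall x, ~ N x -> u x = v x) ->
  (forall x, (0 <= v x)%E) -> (forall x, (0 <= u x)%E) ->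
   ereal_sup [set sintegral mu h |
     h in [set h : {nnsfun T >-> R} | forall x, (h x)%:E <= u x]%E] =
   ereal_sup [set sintegral mu h |
     h in [set h : {nnsfun T >-> R} | forall x, (h x)%:E <= v x]%E].
  move=> uv v0 u0; apply/eqP; rewrite eq_le !half// => x xN.
  by rewrite uv.
have fg x : ~ N x -> f x = g x by move=> Nx; apply: contrapT => /fgN.
rewrite /integral !patch_setT; congr (_ - _)%E; apply: half => //.
  by move=> x /fg; rewrite !funeposE => ->.
by move=> x /fg; rewrite !funenegE => ->.
Qed.

End nonmeasurable.

(** A non-integrable measurable function has an infinite integral, whose
    real value is 0 by convention; both sides then vanish. *)
Lemma RintegralZl_measurable d (T : measurableType d) (R : realType)
    (mu : {measure set T -> \bar R}) (D : set T) (f : T -> R) (c : R) : c != 0 ->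
  measurable D -> measurable_fun D f ->
  \int[mu]_(x in D) (c * f x) = c * \int[mu]_(x in D) f x.
Proof.
move=> c0 mD mf.
have [fD|fD] := pselect (mu.-integrable D (EFin \o f)); first exact: RintegralZl.
have div (g : T -> R) : measurable_fun D g -> ~ mu.-integrable D (EFin \o g) ->
    \int[mu]_(x in D) g x = 0.
  move=> mg gD; rewrite /Rintegral.
  have [gfin|] := boolP (\int[mu]_(x in D) (g x)%:E \is a fin_num)%E; last first.
    by rewrite fin_numEn => /orP[] /eqP ->.
  case: gD; apply/integrableP; split; first exact/measurable_EFinP.
  by rewrite (integral_fin_num_abs mu mD mg).
rewrite [X in c * X]div// mulr0 div//; first exact: measurable_funM.
move=> cfD; apply: fD.
have := integrableZl mD c^-1 cfD; apply: eq_integrable => // x _ /=.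
by rewrite -EFinM mulKf.
Qed.

(** * Affine changes of variable on the line *)

Section affine_substitution.
Context {R : realType}.
Notation mu := (@lebesgue_measure R).

Lemma pushforward_lebesgue_shift (b : R) (A : set R) : measurable A ->
  pushforward mu (fun x => x + b : measurableTypeR R) A = mu A.
Proof.
move=> mA.
have mphi : measurable_fun setT (fun x : R => x + b : measurableTypeR R).
  exact: measurable_funD.
pose phi : {mfun R >-> measurableTypeR R} :=
  HB.pack (fun x : R => x + b : measurableTypeR R)
    (isMeasurableFun.Build _ _ _ _ _ mphi).
rewrite -[LHS]/(pushforward mu phi A).
apply/esym/lebesgue_measure_unique => //= _ [[c d]] _ <-.
rewrite /pushforward/=.
have -> : (fun x => x + b) @^-1` [set` `]c, d]] = [set` `]c - b, d - b]].
  by apply/seteqP; split=> x /=; rewrite !in_itv/= ltrBlDr lerBrDr.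
rewrite !lebesgue_measure_itv/= !lte_fin ltrD2r.
by case: ifP => // _; rewrite -!EFinD; congr EFin; ring.
Qed.

Lemma pushforward_lebesgue_scale (a : R) (a0 : 0 < a) (A : set R) : measurable A ->
  (a%:E * pushforward mu (fun x => (a * x)%R : measurableTypeR R) A)%E = mu A.
Proof.
move=> mA; pose c : {nonneg R} := NngNum (ltW a0).
have mf : measurable_fun setT (fun x : R => a * x : measurableTypeR R).
  exact: measurable_funM.
pose phi : {mfun R >-> measurableTypeR R} :=
  HB.pack (fun x : R => a * x : measurableTypeR R)
    (isMeasurableFun.Build _ _ _ _ _ mf).
apply/esym; apply: (lebesgue_measure_unique (mu := mscale c (pushforward mu phi)))
  => //= _ [[p q]] _ <-.
rewrite /mscale/= /pushforward.
have -> : (fun x => a * x) @^-1` [set` `]p, q]] = [set` `]p / a, q / a]].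
  by apply/seteqP; split=> x /=; rewrite !in_itv/= ltr_pdivrMr// ler_pdivlMr// mulrC.
rewrite !lebesgue_measure_itv/= !lte_fin ltr_pM2r ?invr_gt0//.
case: ifP => // _; last by rewrite mule0.
by rewrite -!EFinD -EFinM; congr EFin; field; rewrite gt_eqF.
Qed.

Lemma integral_preserving (phi : R -> R) (f : R -> \bar R) :
  measurable_fun setT (phi : R -> measurableTypeR R) ->
  (forall A, measurable A -> pushforward mu (phi : R -> measurableTypeR R) A = mu A) ->
  measurable_fun setT f ->
  (\int[mu]_x f (phi x) = \int[mu]_x f x)%E.
Proof.
move=> mphi pres mf.
have ge0 (g : R -> \bar R) : measurable_fun setT g -> (forall x, (0 <= g x)%E) ->
    (\int[mu]_x g (phi x) = \int[mu]_x g x)%E.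
  move=> mg g0.
  rewrite -[LHS](@ge0_integral_pushforward _ _ (measurableTypeR R)
    (measurableTypeR R) R phi mphi mu setT g)//.
  by apply: eq_measure_integral => A mA _; exact: pres.
rewrite integralE [RHS]integralE.
congr (_ - _)%E.
  transitivity (\int[mu]_x f^\+ (phi x))%E; last first.
    by apply: ge0 => //; exact: measurable_funepos.
  by apply: eq_integral => x _; rewrite (funepos_comp f phi).
transitivity (\int[mu]_x f^\- (phi x))%E; last first.
  by apply: ge0 => //; exact: measurable_funeneg.
by apply: eq_integral => x _; rewrite (funeneg_comp f phi).
Qed.

Lemma integral_shift (b : R) (f : R -> \bar R) : measurable_fun setT f ->
  (\int[mu]_x f (x + b)%R = \int[mu]_x f x)%E.
Proof.
apply: (@integral_preserving (fun x => x + b)).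
  exact: measurable_funD.
exact: pushforward_lebesgue_shift.
Qed.

Lemma integral_reflect (c : R) (f : R -> \bar R) : measurable_fun setT f ->
  (\int[mu]_x f (c - x)%R = \int[mu]_x f x)%E.
Proof.
move=> mf; rewrite -[RHS](integral_shift c)//.
rewrite -[RHS](@integral_preserving -%R).
- by apply: eq_integral => x _; rewrite addrC.
- exact: (measurable_funN (@measurable_id _ _ setT)).
- exact: lebesgue_measureN.
- by apply: measurableT_comp => //; exact: measurable_funD.
Qed.

(** It is this scaling that makes the Gamma integral the Laplace transform
    of a power. *)
Lemma ge0_integral_scale (a : R) (f : R -> \bar R) : 0 < a ->
  measurable_fun setT f -> (forall x, (0 <= f x)%E) ->
  (a%:E * \int[mu]_x f (a * x)%R = \int[mu]_x f x)%E.
Proof.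
move=> a0 mf f0; pose c : {nonneg R} := NngNum (ltW a0).
have mphi : measurable_fun setT (fun x : R => a * x : measurableTypeR R).
  exact: measurable_funM.
rewrite -[X in (_ * X)%E](@ge0_integral_pushforward _ _ (measurableTypeR R)
  (measurableTypeR R) R _ mphi mu setT f)//.
have := @ge0_integral_mscale _ (measurableTypeR R) R
  (pushforward mu ((fun x => a * x) : measurableTypeR R -> measurableTypeR R))
  setT measurableT c f.
move=> /= <- //.
by apply: eq_measure_integral => A mA _; exact: pushforward_lebesgue_scale.
Qed.

End affine_substitution.

(** * Fubini for convolutions *)

Section convolution.
Context {R : realType}.
Notation mu := (@lebesgue_measure R).

Lemma measurable_convolution_kernel (k phi : R -> R) :
  measurable_fun setT k -> measurable_fun setT phi ->
  measurable_fun setT (fun z : R * R => k z.2 * phi (z.1 - z.2)).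
Proof.
move=> mk mphi; apply: measurable_funM.
  exact: measurableT_comp.
apply: measurableT_comp => //.
exact: measurable_funB.
Qed.

Lemma integrable_convolution_kernel (k phi : R -> R) :
  mu.-integrable setT (EFin \o k) -> mu.-integrable setT (EFin \o phi) ->
  (mu \x mu)%E.-integrable setT
    (EFin \o (fun z : R * R => k z.2 * phi (z.1 - z.2))).
Proof.
move=> ik iphi.
have mk : measurable_fun setT k by move/measurable_int/measurable_EFinP : ik.
have mphi : measurable_fun setT phi.
  by move/measurable_int/measurable_EFinP : iphi.
apply/integrable21ltyP.
  by apply/measurable_EFinP; exact: measurable_convolution_kernel.
under eq_integral => y _.
  under eq_integral => x _.
    rewrite /= normrM EFinM.
    over.
  rewrite ge0_integralZl//; last first.
    apply/measurable_EFinP; apply: measurableT_comp => //.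
    by apply: (measurableT_comp mphi); exact: measurable_funB.
  rewrite (@integral_shift _ (- y) (fun x => `|phi x|%:E)); last first.
    by apply/measurable_EFinP; exact: measurableT_comp.
  over.
rewrite ge0_integralZr//; last 2 first.
- by apply/measurable_EFinP; exact: measurableT_comp.
- by apply: integral_ge0 => x _; rewrite lee_fin.
move/integrableP : ik => [_ ik]; move/integrableP : iphi => [_ iphi].
by apply: lte_mul_pinfty => //; rewrite ?integral_ge0// ge0_fin_numE// integral_ge0.
Qed.

Definition convolution (k phi : R -> R) (t : R) : R :=
  \int[mu]_y (k y * phi (t - y)).

(** Where the inner integral diverges the convolution takes the value 0, so
    it is bounded by the extended-real inner integral at every point. *)
Lemma integrable_convolution (k phi : R -> R) :
  mu.-integrable setT (EFin \o k) -> mu.-integrable setT (EFin \o phi) ->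
  mu.-integrable setT (EFin \o convolution k phi).
Proof.
move=> ik iphi; have iF := integrable_convolution_kernel ik iphi.
apply: (le_integrable _ _ _ (integrable_fubini_F iF)) => //.
  apply/measurable_EFinP; apply: (measurableT_comp (@fine_measurable _ setT measurableT)).
  exact: measurable_fubini_F iF.
move=> x _; rewrite /= /convolution /Rintegral /fubini_F/=.
by case: (integral _ _ _) => [r| |]; rewrite //= ?normr0 leey.
Qed.

Lemma integrable_shift (phi : R -> R) (b : R) :
  mu.-integrable setT (EFin \o phi) ->
  mu.-integrable setT (fun t => (phi (t + b))%:E).
Proof.
move=> /integrableP[mphi iphi].
have mb : measurable_fun setT (fun t : R => t + b) by exact: measurable_funD.
apply/integrableP; split; first exact: (measurableT_comp mphi).
rewrite (@integral_shift _ b (fun x => `|phi x|%:E))//.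
apply/measurable_EFinP; apply: measurableT_comp => //.
by apply/measurable_EFinP.
Qed.

Lemma integrable_weight (w phi : R -> R) : measurable_fun setT w ->
  (forall t, `|w t| <= 1) -> mu.-integrable setT (EFin \o phi) ->
  mu.-integrable setT (fun t => (w t * phi t)%:E).
Proof.
move=> mw w1 iphi; apply: (le_integrable _ _ _ iphi) => //.
  apply/measurable_EFinP; apply: measurable_funM => //.
  by move/measurable_int/measurable_EFinP : iphi.
by move=> x _; rewrite lee_fin normrM ler_piMl.
Qed.

(** The weight w makes one statement serve for two purposes: with w the
    indicator of [0, T] it integrates a convolution up to T, and with w = 1 it
    computes the total mass, hence the Laplace transform, of a convolution. *)
Lemma convolution_Fubini (w k phi : R -> R) : measurable_fun setT w ->
  (forall t, `|w t| <= 1) ->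
  mu.-integrable setT (EFin \o k) -> mu.-integrable setT (EFin \o phi) ->
  \int[mu]_t (w t * convolution k phi t) =
  \int[mu]_y (k y * \int[mu]_t (w t * phi (t - y))).
Proof.
move=> mw w1 ik iphi; have iF := integrable_convolution_kernel ik iphi.
have iwF : (mu \x mu)%E.-integrable setT
    (EFin \o (fun z : R * R => w z.1 * (k z.2 * phi (z.1 - z.2)))).
  apply: (le_integrable _ _ _ iF) => //.
    apply/measurable_EFinP; apply: measurable_funM.
      exact: measurableT_comp.
    by move/measurable_int/measurable_EFinP : iF.
  by move=> x _; rewrite lee_fin /= normrM ler_piMl.
congr fine; have := Fubini iwF => /= E.
transitivity (\int[mu]_x \int[mu]_y (w x * (k y * phi (x - y)))%:E)%E.
  apply: ae_eq_integral_nonmeasurable; have := ae_integrable1 iF.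
  apply: filterS => x /= ix; rewrite /convolution -RintegralZl//.
  rewrite /Rintegral fineK//; apply: integrable_fin_num => //.
  exact: (integrableZl _ (w x) ix).
rewrite E; apply: eq_integral => y _.
have iy : mu.-integrable setT (fun t => (w t * phi (t - y))%:E).
  by apply: integrable_weight => //; exact: (@integrable_shift phi (- y)).
rewrite -RintegralZl// /Rintegral fineK.
  by apply: eq_integral => x _; rewrite mulrCA.
by apply: integrable_fin_num => //; exact: (integrableZl _ (k y) iy).
Qed.

End convolution.

(** * The Gamma integral and the Laplace transform of a power *)

Section gamma_integral.
Context {R : realType}.
Notation mu := (@lebesgue_measure R).

Lemma continuous_powR_pos (p x : R) : 0 < x -> {for x, continuous (@powR R ^~ p)}.
Proof.
move=> x0; apply/differentiable_continuous/derivable1_diffP.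
by have [] := is_derive1_powR p x0.
Qed.

Lemma integral_powR_itv (alpha e : R) : 0 < alpha -> alpha < 1 -> 0 < e -> e < 1 ->
  (\int[mu]_(x in `[e, 1%R]) (x `^ (- alpha))%:E <= ((1 - alpha)^-1)%:E)%E.
Proof.
move=> a0 a1 e0 e1.
have gt0 x : e <= x -> 0 < x by exact: lt_le_trans.
have a1' : 1 - alpha != 0 by rewrite subr_eq0 gt_eqF.
rewrite (@continuous_FTC2 _ _ (fun x => (1 - alpha)^-1 * x `^ (1 - alpha)))//.
- rewrite -EFinD lee_fin powR1 mulr1 gerBl mulr_ge0 ?powR_ge0// invr_ge0 subr_ge0.
  exact: ltW.
- apply/continuous_within_itvP => //; split.
  + move=> x; rewrite in_itv/= => /andP[ex _].
    exact/continuous_powR_pos/gt0/ltW.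
  + exact/cvg_at_right_filter/continuous_powR_pos.
  + exact/cvg_at_left_filter/continuous_powR_pos.
- have cF x : e <= x -> {for x, continuous (fun x => (1 - alpha)^-1 * x `^ (1 - alpha))}.
    move=> /gt0 x0; apply: continuousM; first exact: cvg_cst.
    exact: continuous_powR_pos.
  split.
  + move=> x; rewrite in_itv/= => /andP[/ltW/gt0 x0 _].
    apply: derivableM => //; by have [] := is_derive1_powR (1 - alpha) x0.
  + exact/cvg_at_right_filter/cF.
  + exact/cvg_at_left_filter/cF/ltW.
- move=> x; rewrite in_itv/= => /andP[/ltW/gt0 x0 _].
  rewrite derive1Ml; last by have [] := is_derive1_powR (1 - alpha) x0.
  rewrite powR_derive1 ?in_itv/= ?x0// mulrA mulVf// mul1r.
  by congr (_ `^ _); ring.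
Qed.

(** The singularity at 0 is reached by monotone convergence from the
    intervals [1/(n+2), 1], on which the fundamental theorem of calculus
    applies. *)
Lemma integral_powR01 (alpha : R) : 0 < alpha -> alpha < 1 ->
  (\int[mu]_(x in `]0%R, 1%R]) (x `^ (- alpha))%:E < +oo)%E.
Proof.
move=> a0 a1; pose F n := `[n.+2%:R^-1, 1 : R]%classic.
have -> : `]0, 1]%classic = \bigcup_n F n.
  apply/seteqP; split=> x /=.
    rewrite in_itv/= => /andP[x0 x1].
    exists (Num.bound x^-1) => //; rewrite /F/= in_itv/= x1 andbT.
    rewrite invf_ple ?posrE//; apply/ltW/(lt_trans (archi_boundP _)).
      by rewrite invr_ge0 ltW.
    by rewrite ltr_nat ltnS.
  by move=> [n _]; rewrite /F/= !in_itv/= => /andP[nx ->]; rewrite andbT (lt_le_trans _ nx).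
apply: (@le_lt_trans _ _ ((1 - alpha)^-1)%:E); last exact: ltry.
have cv : (\int[mu]_(x in F i) (x `^ (- alpha))%:E @[i --> \oo] -->
   \int[mu]_(x in \bigcup_i F i) (x `^ (- alpha))%:E)%E.
  apply: ge0_nondecreasing_set_cvg_integral => //.
  - move=> m n mn; apply/subsetPset => x; rewrite /F/= !in_itv/= => /andP[mx ->].
    by rewrite andbT (le_trans _ mx)// lef_pV2 ?posrE// ler_nat; lia.
  - by move=> n; exact: measurable_itv.
  - by move=> n; apply/measurable_EFinP; exact: measurable_funTS.
  - by move=> n x _; rewrite lee_fin powR_ge0.
apply: (cvge_to_le cv).
apply: nearW => n; apply: integral_powR_itv => //.
by rewrite invf_lt1// ltr1n.
Qed.

Lemma measurable_expRNM (s : R) : measurable_fun setT (fun x : R => expR (- (s * x))).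
Proof.
apply: (measurableT_comp (@measurable_expR R)).
apply: (measurable_funN (f := fun x : R => s * x)).
exact: measurable_funM.
Qed.

(** The kernel of the Caputo derivative, extended by 0 so that convolutions
    over the whole line are convolutions over [0, t].  The truncation also
    removes the negative half-line, where the power is not 0. *)
Definition truncated_powR (alpha : R) : R -> R :=
  (fun x => x `^ (- alpha)) \_ `]0, +oo[.

Lemma truncated_powR_ge0 alpha x : 0 <= truncated_powR alpha x.
Proof. by rewrite /truncated_powR patchE; case: ifP => // _; exact: powR_ge0. Qed.

Lemma measurable_truncated_powR alpha : measurable_fun setT (truncated_powR alpha).
Proof.
apply/(measurable_restrictT _ _).1; first exact: measurable_itv.
by apply: measurable_funTS.
Qed.

Lemma integrable_exponential_pdf (s : R) : 0 < s ->
  mu.-integrable setT (EFin \o exponential_pdf s).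
Proof.
move=> s0; apply/integrableP; split.
  by apply/measurable_EFinP; exact: measurable_exponential_pdf.
under eq_integral do rewrite /= ger0_norm ?exponential_pdf_ge0 ?ltW//.
by rewrite integral_exponential_pdf// ltry.
Qed.

(** The power dominates on ]0, 1] and the exponential on ]1, +oo[. *)
Lemma integrable_gamma_kernel (alpha : R) : 0 < alpha -> alpha < 1 ->
  mu.-integrable setT (fun x => (truncated_powR alpha x * expR (- x))%:E).
Proof.
move=> a0 a1.
have mexp : measurable_fun setT (fun x : R => expR (- x)).
  by apply: measurableT_comp => //; exact: measurable_funN.
have ik : mu.-integrable setT (((fun x : R => (x `^ (- alpha))%:E) \_ `]0%R, 1%R])%E).
  apply: (proj1 (integrable_mkcond _ _)); first exact: measurable_itv.
  apply/integrableP; split.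
    by apply/measurable_EFinP; exact: measurable_funTS.
  under eq_integral do rewrite gee0_abs ?lee_fin ?powR_ge0//.
  exact: integral_powR01.
have ie := integrable_exponential_pdf ltr01.
apply: le_integrable (integrableD measurableT ik ie) => //.
  apply/measurable_EFinP; apply: measurable_funM => //.
  exact: measurable_truncated_powR.
move=> x _; have e0 := exponential_pdf_ge0 (@ler01 R) x.
rewrite /= !patchE /truncated_powR patchE !mem_setE !in_itv/= andbT.
have [x0|x0] := ltP 0 x; last by rewrite mul0r normr0 abse_ge0.
have [x1|x1] := leP x 1; rewrite -EFinD lee_fin.
  rewrite !ger0_norm ?addr_ge0 ?mulr_ge0 ?powR_ge0 ?expR_ge0//.
  by rewrite ler_wpDr// ler_piMr ?powR_ge0// expR_le1; lra.
rewrite add0r !ger0_norm ?mulr_ge0 ?powR_ge0 ?expR_ge0//.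
rewrite (exponential_pdfE _ (ltW x0)) mul1r mulN1r ler_piMl ?expR_ge0//.
rewrite powRN invf_le1 ?powR_gt0//.
by rewrite -[leLHS](powRr0 x) ler_powR ?ltW.
Qed.

Lemma GammaE (alpha : R) : alpha != 0 ->
  Gamma (1 - alpha) = \int[mu]_x (truncated_powR alpha x * expR (- x)).
Proof.
move=> a0; rewrite /Gamma Rintegral_mkcond; apply: eq_Rintegral => x _.
rewrite /truncated_powR !patchE; case: ifP => // _; last by rewrite mul0r.
by congr (_ `^ _ * _); ring.
Qed.

Lemma Gamma_gt0 (alpha : R) : 0 < alpha -> alpha < 1 -> 0 < Gamma (1 - alpha).
Proof.
move=> a0 a1; rewrite GammaE ?gt_eqF//.
(* c is the minimum of the integrand on [1, 2] *)
pose c : R := 2 `^ (- alpha) * expR (- 2).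
have c0 : 0 < c by rewrite mulr_gt0 ?powR_gt0 ?expR_gt0.
apply: (@lt_le_trans _ _ (\int[mu]_x (c * \1_(`[1, 2]%classic) x))).
  rewrite RintegralZl//; last exact: integrable_indic_itv.
  rewrite mulr_gt0// /Rintegral integral_indic// setIT/= lebesgue_measure_itv/=.
  by rewrite lte_fin ltr1n -EFinD/=; lra.
apply: le_Rintegral => //.
- exact: (integrableZl measurableT c (@integrable_indic_itv R 1 2 true false)).
- exact: integrable_gamma_kernel.
move=> x _; rewrite indicE.
have [|] := boolP (x \in `[1, 2]%classic); last first.
  by rewrite mulr0 mulr_ge0 ?expR_ge0// truncated_powR_ge0.
rewrite inE/= in_itv/= => /andP[x1 x2]; have x0 : 0 < x by lra.
rewrite /truncated_powR patchE mem_set/=; last by rewrite in_itv/= x0.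
rewrite mulr1 ler_pM ?powR_ge0 ?expR_ge0// ?ler_expR ?lerN2//.
rewrite !powRN lef_pV2 ?posrE ?powR_gt0//.
by rewrite ge0_ler_powR ?nnegrE// ?ltW.
Qed.

Lemma integral_laplace_powR (alpha s : R) : 0 < alpha -> alpha < 1 -> 0 < s ->
  mu.-integrable setT (fun x => (expR (- (s * x)) * truncated_powR alpha x)%:E) /\
  \int[mu]_x (expR (- (s * x)) * truncated_powR alpha x) =
    s `^ (alpha - 1) * Gamma (1 - alpha).
Proof.
move=> a0 a1 s0.
have mE : measurable_fun setT
    (fun x => (expR (- (s * x)) * truncated_powR alpha x)%:E).
  apply/measurable_EFinP; apply: measurable_funM.
    exact: measurable_expRNM.
  exact: measurable_truncated_powR.
have ge0 x : 0 <= expR (- (s * x)) * truncated_powR alpha x.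
  by rewrite mulr_ge0 ?expR_ge0// truncated_powR_ge0.
have ik := integrable_gamma_kernel a0 a1.
have E : (\int[mu]_x (expR (- (s * x)) * truncated_powR alpha x)%:E =
    (s `^ (alpha - 1) * Gamma (1 - alpha))%:E)%E.
  have : ((Gamma (1 - alpha))%:E =
     s%:E * \int[mu]_x (truncated_powR alpha (s * x) * expR (- (s * x)))%:E)%E.
    rewrite (@ge0_integral_scale _ s
      (fun x => (truncated_powR alpha x * expR (- x))%:E))//.
    - by rewrite GammaE ?gt_eqF// /Rintegral fineK//; exact: integrable_fin_num.
    - exact: measurable_int ik.
    - by move=> x; rewrite lee_fin mulr_ge0 ?expR_ge0// truncated_powR_ge0.
  rewrite EFinM => ->; rewrite muleA -EFinM.
  have sn0 : s != 0 by rewrite gt_eqF.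
  have sE : s `^ (alpha - 1) * s * s `^ (- alpha) = 1.
    rewrite -[X in _ * X * _]powRr1 ?ltW// -!powRD ?sn0 ?implybT//.
    by rewrite subrK addrN powRr0.
  rewrite -ge0_integralZl//.
  - apply: eq_integral => x _; rewrite -EFinM; congr EFin.
    rewrite /truncated_powR !patchE !mem_setE !in_itv/= !andbT pmulr_rgt0//.
    case: ifP => x0; last by rewrite mul0r !mulr0.
    by rewrite powRM ?ltW// !mulrA sE mul1r mulrC.
  - apply/measurable_EFinP; apply: measurable_funM.
      apply: (measurableT_comp (measurable_truncated_powR alpha)).
      exact: measurable_funM.
    exact: measurable_expRNM.
  - by move=> x _; rewrite lee_fin mulr_ge0 ?expR_ge0// truncated_powR_ge0.
  - by rewrite lee_fin mulr_ge0 ?powR_ge0// ltW.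
split; last by rewrite /Rintegral E.
apply/integrableP; split => //.
under eq_integral do rewrite /= ger0_norm//.
by rewrite E ltry.
Qed.

End gamma_integral.

(** * Laplace transforms *)

Section laplace_transform.
Context {R : realType}.
Notation mu := (@lebesgue_measure R).

Lemma convolutionC (k phi : R -> R) : measurable_fun setT k ->
  measurable_fun setT phi -> convolution k phi = convolution phi k.
Proof.
move=> mk mphi; apply/funext => t; rewrite /convolution /Rintegral; congr fine.
rewrite -(@integral_reflect _ t (fun y => (k y * phi (t - y))%:E)).
  by apply: eq_integral => y _; rewrite opprB addrCA subrr addr0 mulrC.
apply/measurable_EFinP; apply: measurable_funM => //.
apply: (measurableT_comp mphi).
exact: measurable_funB.
Qed.

(** The integrand of the Laplace transform, extended by 0 to the line.
    Damping is multiplicative for convolutions, so that the Laplace transform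
    of a convolution becomes the integral of a convolution over the line. *)
Definition damped (s : R) (f : R -> R) : R -> R :=
  (fun t => expR (- (s * t)) * f t) \_ `[0, +oo[.

Lemma dampedE s f t : 0 <= t -> damped s f t = expR (- (s * t)) * f t.
Proof. by move=> t0; rewrite /damped patchE mem_set//= in_itv/= t0. Qed.

Lemma damped_lt0 s f t : t < 0 -> damped s f t = 0.
Proof.
by move=> t0; rewrite /damped patchE memNset//= in_itv/= andbT; apply/negP; rewrite -ltNge.
Qed.

Lemma laplaceE s f : laplace f s = (\int[mu]_t (damped s f t)%:E)%E.
Proof.
rewrite /laplace integral_mkcond; apply: eq_integral => t _.
by rewrite /damped restrict_EFin.
Qed.

Lemma convolution_damped s (a b : R -> R) (t : R) :
  (0 <= t -> measurable_fun (`[0, t]%classic : set R) (fun y => a y * b (t - y))) ->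
  convolution (damped s a) (damped s b) t =
  damped s (fun t => \int[mu]_(y in `[0, t]) (a y * b (t - y))) t.
Proof.
move=> mab; have [t0|t0] := ltP t 0.
  rewrite damped_lt0// /convolution /Rintegral (eq_integral (cst 0%E)).
    by rewrite integral0.
  move=> y _; have [y0|y0] := ltP y 0; first by rewrite damped_lt0// mul0r.
  by rewrite [X in _ * X]damped_lt0 ?mulr0//; lra.
rewrite dampedE// -RintegralZl_measurable ?gt_eqF ?expR_gt0//; last exact: mab.
rewrite Rintegral_mkcond; apply: eq_Rintegral => y _.
rewrite patchE mem_setE in_itv/=; have [y0|y0] := leP 0 y; last first.
  by rewrite damped_lt0// mul0r.
have [yt|yt] := leP y t; last by rewrite [X in _ * X]damped_lt0 ?mulr0//; lra.
rewrite !dampedE ?subr_ge0// mulrACA -expRD; congr (expR _ * _); ring.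
Qed.

Lemma laplace_convolution s (a b : R -> R) :
  mu.-integrable setT (EFin \o damped s a) ->
  mu.-integrable setT (EFin \o damped s b) ->
  (forall t, 0 <= t -> measurable_fun (`[0, t]%classic : set R) (fun y => a y * b (t - y))) ->
  \int[mu]_t damped s (fun t => \int[mu]_(y in `[0, t]) (a y * b (t - y))) t =
  (\int[mu]_t damped s a t) * (\int[mu]_t damped s b t).
Proof.
move=> ia ib mab.
transitivity (\int[mu]_t (1 * convolution (damped s a) (damped s b) t)).
  by apply: eq_Rintegral => t _; rewrite mul1r convolution_damped// => t0; exact: mab.
rewrite (@convolution_Fubini _ (cst 1))//; last by move=> t; rewrite normr1.
rewrite -RintegralZr//; apply: eq_Rintegral => y _; congr (_ * _).
rewrite /Rintegral; congr fine; under eq_integral do rewrite mul1r.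
rewrite (@integral_shift _ (- y) (EFin \o damped s b))//.
exact: measurable_int ib.
Qed.

(** A bounded function is dominated by a multiple of the exponential
    density. *)
Lemma integrable_damped_bounded s (f : R -> R) (M : R) : 0 < s ->
  measurable_fun (`[0, +oo[%classic : set R) f -> (forall t, 0 <= t -> `|f t| <= M) ->
  mu.-integrable setT (EFin \o damped s f).
Proof.
move=> s0 mf fM.
have ie := integrable_exponential_pdf s0.
apply: (le_integrable _ _ _ (integrableZl measurableT (M / s) ie)) => //.
  apply/measurable_EFinP; apply/(measurable_restrictT _ _).1.
    exact: measurable_itv.
  apply: measurable_funM => //; apply: measurable_funTS.
  exact: measurable_expRNM.
move=> t _; rewrite /= lee_fin; have [t0|t0] := ltP t 0.
  by rewrite damped_lt0// normr0.
rewrite dampedE// exponential_pdfE// mulNr mulrA divfK ?gt_eqF//.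
rewrite mulrC !normrM ler_wpM2r//.
by rewrite (le_trans (fM _ t0))// ler_norm.
Qed.

Lemma Rintegral_damped1 s : 0 < s -> \int[mu]_t damped s (cst 1) t = s^-1.
Proof.
move=> s0; transitivity (s^-1 * \int[mu]_x exponential_pdf s x); last first.
  by rewrite /Rintegral integral_exponential_pdf//= mulr1.
rewrite -RintegralZl//; last exact: integrable_exponential_pdf.
apply: eq_Rintegral => t _; have [t0|t0] := ltP t 0.
  by rewrite damped_lt0// lt0_exponential_pdf// mulr0.
by rewrite dampedE//= mulr1 exponential_pdfE// mulKf ?gt_eqF// mulNr.
Qed.

End laplace_transform.

(** * The Caputo derivative *)

Section caputo_derivative.
Context {R : realType}.
Notation mu := (@lebesgue_measure R).

Lemma integrable_patch (f : R -> R) (T : R) :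
  mu.-integrable `[0, T] (EFin \o f) ->
  mu.-integrable setT (EFin \o (f \_ `[0, T])).
Proof.
move=> fi; rewrite -restrict_EFin.
by apply: (proj1 (integrable_mkcond _ _)) => //; exact: measurable_itv.
Qed.

Lemma ae_neq2 (a b : R) : {ae mu, forall x, x != a /\ x != b}.
Proof.
exists [set a; b]; split.
- exact: measurableU.
- apply/eqP; rewrite eq_le measure_ge0 andbT.
  apply: le_trans (measureU2 _ _ _) _ => //.
  by rewrite /= !lebesgue_measure_set1 adde0.
- by move=> x /= /not_andP[]/negP; rewrite negbK => /eqP ->; [left|right].
Qed.

(** Integrating the convolution of k and g amounts to convolving k with the
    primitive of g: both are the integral of k y * g u over the triangle
    y + u <= T.  Only local integrability is involved. *)
Lemma Rintegral_convolution_primitive (k g : R -> R) (T : R) : 0 <= T ->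
  mu.-integrable `[0, T] (EFin \o k) -> mu.-integrable `[0, T] (EFin \o g) ->
  \int[mu]_(t in `[0, T]) (\int[mu]_(u in `[0, t]) (k (t - u) * g u)) =
  \int[mu]_(y in `[0, T]) (k y * \int[mu]_(u in `[0, T - y]) g u).
Proof.
move=> T0 ik ig.
pose kT := k \_ `[0, T]; pose gT := g \_ `[0, T].
pose w : R -> R := \1_`[0, T].
have ikT := integrable_patch ik; have igT := integrable_patch ig.
have mw : measurable_fun setT w by exact: measurable_indic.
have w1 t : `|w t| <= 1.
  by rewrite /w indicE; case: (_ \in _); rewrite ?normr1 ?normr0.
have := convolution_Fubini mw w1 ikT igT.
rewrite (convolutionC (k := kT)); last 2 first.
  by move/measurable_int/measurable_EFinP : ikT.
  by move/measurable_int/measurable_EFinP : igT.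
move=> E; rewrite Rintegral_mkcond [RHS]Rintegral_mkcond.
transitivity (\int[mu]_t (w t * convolution gT kT t)).
  apply: eq_Rintegral => t _; rewrite patchE /w indicE.
  case: ifP; last by rewrite mul0r.
  rewrite mul1r inE/= in_itv/= => /andP[t0 tT].
  rewrite /convolution [LHS]Rintegral_mkcond; apply: eq_Rintegral => u _.
  rewrite /gT /kT !patchE !mem_setE !in_itv/= subr_ge0 lerBlDr.
  have [u0|u0] := leP 0 u; last by rewrite mul0r.
  have [ut|ut] := leP u t; last by rewrite mulr0.
  rewrite (le_trans ut tT)/= (_ : t <= T + u)/= 1?mulrC//; lra.
rewrite E; apply: eq_Rintegral => y _; rewrite [RHS]patchE /kT [in LHS]patchE.
case: ifP; last by rewrite mul0r.
rewrite inE/= in_itv/= => /andP[y0 yT]; congr (_ * _).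
rewrite [RHS]Rintegral_mkcond /Rintegral; congr fine.
rewrite -(@integral_shift _ y (fun t => (w t * gT (t - y))%:E)).
  apply: eq_integral => t _; rewrite addrK /w indicE /gT !patchE !mem_setE !in_itv/=.
  congr EFin; have [t0|t0] := leP 0 t; last by rewrite mulr0.
  rewrite lerBrDr (addr_ge0 t0 y0)/=.
  have [tyT|tyT] := leP (t + y) T; last by rewrite mul0r.
  by rewrite mul1r (_ : t <= T)//; lra.
apply/measurable_EFinP; apply: measurable_funM => //.
apply: (measurableT_comp (f := gT)); last exact: measurable_funB.
by move/measurable_int/measurable_EFinP : igT.
Qed.

(** Lebesgue differentiation, applied to g cut off outside [0, T]; the
    cut-off is invisible near a point of ]0, T[. *)
Lemma derive1_primitive_ae (f g : R -> R) (T : R) :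
  mu.-integrable `[0, T] (EFin \o g) ->
  (forall t, 0 <= t -> f t = f 0 + \int[mu]_(u in `[0, t]) g u) ->
  {ae mu, forall x, 0 < x < T -> derive1 f x = g x}.
Proof.
move=> ig fE; pose gT := g \_ `[0, T].
have igT := integrable_patch ig.
have intf y : mu.-integrable [set` Interval (BLeft 0) (BRight y)] (EFin \o gT).
  by apply: integrableS igT.
have locf : locally_integrable setT gT.
  by apply: integrable_locally_restrict ig.
have := FTC1 intf locf; apply: filterS.
  exact: (ae_filter_ringOfSetsType mu).
move=> x /= FTC /andP[x0 xT].
have {FTC} [dF F'] := FTC (ltac:(by rewrite lte_fin)).
have nearE : \forall y \near x, f y =
    f 0 + \int[mu]_(u in `[0, y]) gT u.
  near=> y; have y0 : 0 < y by near: y; exact: lt_nbhsr.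
  have yT : y < T by near: y; exact: lt_nbhsl.
  rewrite fE ?ltW//; congr (_ + _); apply: eq_Rintegral => u.
  rewrite inE/= in_itv/= => /andP[u0 uy].
  by rewrite /gT patchE mem_set//= in_itv/= u0 (le_trans uy)// ltW.
rewrite derive1E (near_eq_derive _ nearE) deriveD//.
rewrite derive_cst add0r -derive1E F' /gT patchE mem_set//= in_itv/=.
by rewrite !ltW.
Unshelve. all: by end_near. Qed.

Lemma caputoE (alpha : R) (f g : R -> R) (t : R) : alpha < 1 ->
  mu.-integrable `[0, t] (EFin \o g) ->
  (forall t, 0 <= t -> f t = f 0 + \int[mu]_(u in `[0, t]) g u) ->
  caputo alpha f t = (Gamma (1 - alpha))^-1 *
    \int[mu]_(u in `[0, t]) ((t - u) `^ (- alpha) * g u).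
Proof.
move=> a1 ig fE; rewrite /caputo a1; congr (_ * _).
rewrite Rintegral_mkcond [RHS]Rintegral_mkcond /Rintegral; congr fine.
apply: ae_eq_integral_nonmeasurable; have := derive1_primitive_ae ig fE.
move=> H; move: (ae_neq2 0 t) H; apply: filterS2.
  exact: (ae_filter_ringOfSetsType mu).
move=> x [x0 xt] f'.
congr EFin; rewrite !patchE mem_setE in_itv/=; case: ifP => // /andP[x0' xt'].
by rewrite f'// !lt_neqAle eq_sym x0 x0' xt.
Qed.

End caputo_derivative.

(** * The Laplace transform of the Caputo derivative *)

Section caputo_laplace.
Context {R : realType}.
Notation mu := (@lebesgue_measure R).

Lemma measurable_fun_itv0y (f : R -> R) :
  (forall T, 0 < T -> measurable_fun (`[0, T]%classic : set R) f) ->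
  measurable_fun (`[0, +oo[%classic : set R) f.
Proof.
move=> mf.
have -> : (`[0, +oo[%classic : set R) = \bigcup_n `[0, n.+1%:R]%classic.
  apply/seteqP; split=> x /=.
    rewrite in_itv/= andbT => x0; exists (Num.bound x) => //=.
    rewrite in_itv/= x0; apply/ltW/(lt_le_trans (archi_boundP x0)).
    by rewrite ler_nat.
  by move=> [n _]; rewrite /= !in_itv/= andbT => /andP[].
apply/measurable_fun_bigcup; first by move=> n; exact: measurable_itv.
by move=> n; exact: mf.
Qed.

Lemma abs_continuous_measurable (f : R -> R) : abs_continuous f ->
  measurable_fun (`[0, +oo[%classic : set R) f.
Proof.
move=> [g [ig fE]]; apply: measurable_fun_itv0y => T T0.
apply: (@eq_measurable_fun _ _ _ _ _ (fun t : R => f 0 + \int[mu]_(u in `[0, t]) g u)).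
  by move=> t; rewrite inE/= in_itv/= => /andP[t0 _]; rewrite -fE.
apply: measurable_funD => //.
apply: subspace_continuous_measurable_fun; first exact: measurable_itv.
exact: (parameterized_integral_continuous (ltW T0) (ig T (ltW T0))).
Qed.

Lemma integrable_bounded_itv (f : R -> R) (M T : R) :
  measurable_fun (`[0, +oo[%classic : set R) f ->
  (forall t, 0 <= t -> `|f t| <= M) -> mu.-integrable `[0, T] (EFin \o f).
Proof.
move=> mf fM; apply: measurable_bounded_integrable => //.
- by rewrite /= lebesgue_measure_itv/=; case: ifP => _; rewrite -?EFinD ltry.
- apply: measurable_funS mf => //.
  by apply: subset_itvl.
- exists M; split; first exact: num_real.
  move=> x Mx t /=; rewrite in_itv/= => /andP[t0 _].
  by rewrite (le_trans (fM _ t0))// ltW.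
Qed.

Lemma integrable_truncated_powR (alpha T : R) : 0 < alpha -> alpha < 1 ->
  mu.-integrable `[0, T] (EFin \o truncated_powR alpha).
Proof.
move=> a0 a1; have [ik _] := integral_laplace_powR a0 a1 ltr01.
(* on [0, T] the damping factor is at least exp (- T) *)
have := integrableZl measurableT (expR T) ik => {}ik.
have {}ik : mu.-integrable `[0, T]
    (fun x => ((expR T)%:E * (expR (- (1 * x)) * truncated_powR alpha x)%:E)%E).
  by apply: integrableS ik => //; exact: measurable_itv.
apply: (le_integrable _ _ _ ik) => //.
  by apply/measurable_EFinP; apply: measurable_funTS; exact: measurable_truncated_powR.
move=> x /=; rewrite in_itv/= => /andP[x0 xT].
rewrite lee_fin mul1r mulrA normrM -expRD ler_peMl// ger0_norm ?expR_ge0//.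
by rewrite -expR0 ler_expR subr_ge0.
Qed.

Section one_function.
Variables (alpha s M N : R) (f h : R -> R).
Hypotheses (a0 : 0 < alpha) (a1 : alpha <= 1) (s0 : 0 < s).
Hypotheses (acf : abs_continuous f) (fM : forall t, 0 <= t -> `|f t| <= M).
Hypotheses (mh : measurable_fun (`[0, +oo[%classic : set R) h).
Hypotheses (hN : forall t, 0 <= t -> `|h t| <= N).
Hypothesis (fh : forall t, 0 < t -> caputo alpha f t = h t).

Let mf := abs_continuous_measurable acf.
Let idf := integrable_damped_bounded s0 mf fM.
Let idh := integrable_damped_bounded s0 mh hN.

Let mf0 : measurable_fun (`[0, +oo[%classic : set R) (fun t => f t - f 0).
Proof. exact: measurable_funB. Qed.

Let f0M t : 0 <= t -> `|f t - f 0| <= M + M.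
Proof.
by move=> t0; rewrite (le_trans (ler_normB _ _))// lerD// fM.
Qed.

Lemma Rintegral_damped_increment :
  \int[mu]_t damped s (fun t => f t - f 0) t =
  \int[mu]_t damped s f t - f 0 / s.
Proof.
have i1 : mu.-integrable setT (EFin \o damped s (cst 1)).
  apply: (@integrable_damped_bounded _ _ _ 1) => // t _.
  by rewrite normr1.
rewrite -(Rintegral_damped1 s0) -RintegralZl// -RintegralB//; last first.
  exact: (integrableZl measurableT (f 0) i1).
apply: eq_Rintegral => t _; have [t0|t0] := ltP t 0.
  by rewrite !damped_lt0// mulr0 subr0.
by rewrite !dampedE//= mulr1 mulrBr [f 0 * _]mulrC.
Qed.

Let mh_prim t : 0 <= t -> measurable_fun (`[0, t]%classic : set R) (fun y => h y * cst 1 (t - y)).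
Proof.
move=> t0; apply: measurable_funM => //.
apply: measurable_funS mh; first exact: measurable_itv.
exact: subset_itvl.
Qed.

Let i1 : mu.-integrable setT (EFin \o damped s (cst 1)).
Proof.
apply: (@integrable_damped_bounded _ _ _ 1) => // t _.
by rewrite normr1.
Qed.

Let primE t : \int[mu]_(y in `[0, t]) (h y * cst 1 (t - y)) =
  \int[mu]_(y in `[0, t]) h y.
Proof. by apply: eq_Rintegral => y _; rewrite mulr1. Qed.

Lemma integrable_damped_primitive :
  mu.-integrable setT
    (EFin \o damped s (fun t => \int[mu]_(y in `[0, t]) h y)).
Proof.
apply: (eq_integrable measurableT _ _ _ (integrable_convolution idh i1)) => t _.
rewrite /= convolution_damped; last by move=> t0; exact: mh_prim.
by congr (damped s _ t)%:E; apply/funext => u; exact: primE.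
Qed.

Lemma Rintegral_damped_primitive :
  \int[mu]_t damped s (fun t => \int[mu]_(y in `[0, t]) h y) t =
  (\int[mu]_t damped s h t) / s.
Proof.
rewrite -(Rintegral_damped1 s0) -laplace_convolution//.
apply: eq_Rintegral => t _; congr (damped s _ t); apply/funext => u.
exact/esym/primE.
Qed.

(** Integrating the equation removes the derivative of f, leaving bounded
    functions and a locally integrable kernel. *)
Lemma Rintegral_caputo_lt1 (T : R) : alpha < 1 -> 0 <= T ->
  Gamma (1 - alpha) * \int[mu]_(t in `[0, T]) h t =
  \int[mu]_(y in `[0, T]) (truncated_powR alpha y * (f (T - y) - f 0)).
Proof.
move=> alt1 T0; have [g [ig fE]] := acf.
transitivity (\int[mu]_(y in `[0, T])
    (truncated_powR alpha y * \int[mu]_(u in `[0, T - y]) g u)); last first.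
  apply: eq_Rintegral => y; rewrite inE/= in_itv/= => /andP[y0 yT].
  by rewrite (fE (T - y)) ?subr_ge0// addrAC subrr add0r.
rewrite -Rintegral_convolution_primitive//; last 2 first.
- exact: integrable_truncated_powR.
- exact: ig.
have mhT : measurable_fun (`[0, T]%classic : set R) h.
  apply: measurable_funS mh; first exact: measurable_itv.
  exact: subset_itvl.
rewrite -RintegralZl//; last exact: integrable_bounded_itv mh hN.
rewrite Rintegral_mkcond [RHS]Rintegral_mkcond /Rintegral; congr fine.
apply: ae_eq_integral_nonmeasurable; exists [set 0]; split => //.
  by rewrite /= lebesgue_measure_set1.
(* the equation is known for t > 0 only *)
move=> t; apply: contra_notP => /eqP/= t0; congr EFin.
rewrite !patchE mem_setE in_itv/=; case: ifP => // /andP[t0' tT].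
have tp : 0 < t by rewrite lt_neqAle eq_sym t0.
rewrite -fh// (caputoE alt1 (ig t t0') fE) mulrA mulfV ?mul1r; last first.
  by rewrite gt_eqF// Gamma_gt0.
apply: eq_Rintegral => u; rewrite inE/= in_itv/= => /andP[u0 ut].
congr (_ * _); rewrite /truncated_powR patchE mem_setE in_itv/= andbT subr_gt0.
case: ifP => // /negbT; rewrite -leNgt => tu.
have -> : u = t by apply/eqP; rewrite eq_le ut tu.
by rewrite subrr powR0// oppr_eq0 gt_eqF.
Qed.

Lemma Rintegral_caputo_eq1 (T : R) : alpha = 1 -> 0 <= T ->
  \int[mu]_(t in `[0, T]) h t = f T - f 0.
Proof.
move=> a_eq1 T0; have [g [ig fE]] := acf.
rewrite fE// addrAC subrr add0r.
rewrite Rintegral_mkcond [RHS]Rintegral_mkcond /Rintegral; congr fine.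
apply: ae_eq_integral_nonmeasurable; have := derive1_primitive_ae (ig T T0) fE.
move=> H; move: (ae_neq2 0 T) H; apply: filterS2.
  exact: (ae_filter_ringOfSetsType mu).
move=> x [x0 xT] f'; congr EFin.
rewrite !patchE mem_setE in_itv/=; case: ifP => // /andP[x0' xT'].
have xp : 0 < x by rewrite lt_neqAle eq_sym x0.
rewrite -fh// /caputo a_eq1 ltxx f'// xp.
by rewrite lt_neqAle xT.
Qed.

(** For alpha < 1 both sides of the integrated equation are convolutions, so
    their Laplace transforms are products.  The factor 1/s coming from the
    primitive of h and the factor Gamma(1 - alpha) then cancel. *)
Theorem Rintegral_damped_caputo :
  \int[mu]_t damped s h t =
  s `^ alpha * \int[mu]_t damped s f t - s `^ (alpha - 1) * f 0.
Proof.
have sn0 : s != 0 by rewrite gt_eqF.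
have Dh : \int[mu]_t damped s h t = s *
    \int[mu]_t damped s (fun t => \int[mu]_(y in `[0, t]) h y) t.
  by rewrite Rintegral_damped_primitive mulrCA divff// mulr1.
rewrite Dh; move: (a1); rewrite le_eqVlt => /predU1P[a_eq1|alt1].
  rewrite a_eq1 powRr1 ?ltW// subrr powRr0 mul1r.
  transitivity (s * \int[mu]_t damped s (fun t => f t - f 0) t).
    congr (_ * _); apply: eq_Rintegral => t _; have [t0|t0] := ltP t 0.
      by rewrite !damped_lt0.
    by rewrite !dampedE// Rintegral_caputo_eq1.
  by rewrite Rintegral_damped_increment; field.
have G0 : Gamma (1 - alpha) != 0 by rewrite gt_eqF// Gamma_gt0.
have [ik kE] := integral_laplace_powR a0 alt1 s0.
have dk t : damped s (truncated_powR alpha) t =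
    expR (- (s * t)) * truncated_powR alpha t.
  have [t0|t0] := ltP t 0; last by rewrite dampedE.
  rewrite damped_lt0// /truncated_powR patchE memNset ?mulr0//=.
  by rewrite in_itv/= andbT; apply/negP; rewrite -leNgt ltW.
have {}ik : mu.-integrable setT (EFin \o damped s (truncated_powR alpha)).
  by apply: eq_integrable ik => // t _ /=; rewrite dk.
have {}kE : \int[mu]_t damped s (truncated_powR alpha) t =
    s `^ (alpha - 1) * Gamma (1 - alpha).
  by rewrite -kE; apply: eq_Rintegral => t _; rewrite dk.
have idf0 := integrable_damped_bounded s0 mf0 f0M.
have := laplace_convolution ik idf0.
rewrite kE Rintegral_damped_increment => E.
have {E} : Gamma (1 - alpha) *
    \int[mu]_t damped s (fun t => \int[mu]_(y in `[0, t]) h y) t =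
    s `^ (alpha - 1) * Gamma (1 - alpha) * (\int[mu]_t damped s f t - f 0 / s).
  rewrite -E.
    rewrite -RintegralZl//; last exact: integrable_damped_primitive.
    apply: eq_Rintegral => t _; have [t0|t0] := ltP t 0.
      by rewrite !damped_lt0// mulr0.
    by rewrite !dampedE// -Rintegral_caputo_lt1// mulrCA.
  move=> t t0; apply: measurable_funM.
    by apply: measurable_funTS; exact: measurable_truncated_powR.
  have mtB : measurable_fun (`[0, t]%classic : set R) (fun y => t - y).
    by apply: measurable_funTS; exact: measurable_funB.
  apply: (measurable_comp _ _ mf0 mtB).
  - exact: measurable_itv.
  - move=> _ [y /= + <-]; rewrite !in_itv/= => /andP[_ yt].
    by rewrite subr_ge0 yt.
rewrite [X in _ = X]mulrAC [RHS]mulrC => /(mulfI G0) ->.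
have -> : s `^ alpha = s `^ (alpha - 1) * s.
  rewrite -[X in _ * X]powRr1 ?ltW// -powRD ?sn0 ?implybT//.
  by rewrite subrK.
by field.
Qed.

End one_function.

End caputo_laplace.

(** * Sequences of jumps *)

(** In a tuple of Theta a jump of size i made from state n0 + p occupies
    column p, and the columns of the states that it skips are 0. *)
Definition append_jump (p m i : nat) (x : 'rV[nat]_p) : 'rV[nat]_m :=
  x *m Qmx p m + unit_row m (p + 1) *+ i.

Lemma append_jumpE p m i (x : 'rV[nat]_p) (j : 'I_m) :
  (p < m)%N -> append_jump m i x ord0 j =
  if insub (j : nat) is Some j' then x ord0 j' else ((j == p :> nat) * i)%N.
Proof.
move=> pm; rewrite /append_jump !mxE.
have -> : ((unit_row m (p + 1) *+ i) ord0 j = (j == p :> nat) * i)%N.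
  have E n : (unit_row m (p + 1) *+ n) ord0 j = ((j == p :> nat) * n)%N.
    elim: n => [|n IH]; first by rewrite mulr0n mxE muln0.
    by rewrite mulrS mxE IH mxE addn1 eqSS mulnS.
  exact: E.
case: insubP => [j' jp j'j|jp].
  rewrite (bigD1 j')//= big1 => [|l lj'].
    rewrite !mxE j'j eqxx jp/= mulr1 addr0.
    by rewrite (ltn_eqF jp) mul0n addr0.
  rewrite !mxE; case: eqP => [lj|_]; last by rewrite mulr0.
  by move: lj'; rewrite -val_eqE /= j'j lj eqxx.
rewrite big1 ?add0r// => l _; rewrite !mxE; case: eqP => [lj|_]; last by rewrite mulr0.
by move: jp; rewrite -lj ltn_ord.
Qed.

Lemma append_jump_lt p m i (x : 'rV[nat]_p) (j : 'I_m) (jp : (j < p)%N) :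
  (p < m)%N -> append_jump m i x ord0 j = x ord0 (Ordinal jp).
Proof.
move=> pm; rewrite append_jumpE//; case: insubP => [j' _ j'j|]; last by rewrite jp.
by congr (x _ _); apply/val_inj.
Qed.

Lemma append_jump_ge p m i (x : 'rV[nat]_p) (j : 'I_m) : (p <= j)%N ->
  append_jump m i x ord0 j = ((j == p :> nat) * i)%N.
Proof.
move=> pj; rewrite append_jumpE ?(leq_ltn_trans pj)//.
by case: insubP => // j' jp; rewrite ltnNge pj in jp.
Qed.

Lemma append_jump_inj p m i : (p < m)%N -> injective (@append_jump p m i).
Proof.
move=> pm x y xy; apply/rowP => j.
have jm : (j < m)%N by rewrite (ltn_trans _ pm).
have jp : (Ordinal jm < p)%N by exact: (ltn_ord j).
have E z : append_jump m i z ord0 (Ordinal jm) = z ord0 j.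
  by rewrite (append_jump_lt _ _ jp)//; congr (z _ _); apply: val_inj.
by rewrite -!E xy.
Qed.

(** The size of the last jump can be read off: it sits in the last nonzero
    column. *)
Lemma append_jump_neq m i j (x : 'rV[nat]_(m - i)) (y : 'rV[nat]_(m - j)) :
  (0 < i)%N -> (i < j)%N -> (j <= m)%N -> append_jump m i x <> append_jump m j y.
Proof.
move=> i0 ij jm xy; have im : (m - i < m)%N by lia.
have := congr1 (fun z : 'rV_m => z ord0 (Ordinal im)) xy.
rewrite /= !append_jump_ge/=; [|lia|lia].
by rewrite eqxx mul1n (_ : (m - i == m - j)%N = false) ?mul0n; lia.
Qed.

(** At dimension 0 there is one sequence of jumps, the empty one.  With it a
    single jump from n0 is an appended jump like any other, and the summand at
    m = 0 is the transform of the initial state. *)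
Definition Theta0 (k n : nat) : set 'rV[nat]_n :=
  if n == 0%N then setT else Theta k n.

Arguments Theta0 k n : clear implicits.

Lemma Theta_stable k n : (0 < n)%N -> (n <= k)%N -> Theta k n = Theta n n.
Proof.
move=> n0 nk; have [n1|n1] := leqP n 1; last by rewrite !Theta_high.
by have -> : n = 1%N by lia.
Qed.

Lemma Theta0_finite k n : finite_set (Theta0 k n).
Proof.
rewrite /Theta0; case: eqP => [->|_]; last exact: finite_Theta.
by apply: (sub_finite_set _ (finite_set1 (0 : 'rV[nat]_0))) => x _; rewrite thinmx0.
Qed.

(** The two cases of the definition of Theta merge: for k >= m the extra
    tuple is the jump of size m appended to the empty sequence. *)
Lemma Theta_append k m : (0 < k)%N -> (0 < m)%N ->
  Theta k m = \bigcup_(i in [set i | (1 <= i <= minn m k)%N])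
    (@append_jump (m - i) m i) @` (Theta0 k (m - i)).
Proof.
move=> k0 m0.
have top x : (@append_jump (m - m) m m) x = unit_row m 1 *+ m.
  apply/rowP => j; rewrite /append_jump mxE [X in X + _]mxE big1 ?add0r.
    by rewrite subnn.
  by case=> l lm; exfalso; rewrite subnn in lm.
have topS : (@append_jump (m - m) m m) @` (Theta0 k (m - m)) = [set unit_row m 1 *+ m].
  apply/seteqP; split=> [_ [x _ <-]|_ ->] /=; first exact: top.
  by exists 0; [rewrite /Theta0 subnn|exact: top].
have [m1|m1] := leqP m 1.
  have {m0 m1} mE : m = 1%N by lia.
  subst m; rewrite Theta1; apply/seteqP; split.
    move=> _ ->; exists 1%N; first by rewrite /=; lia.
    suff : [set unit_row 1 1 *+ 1] (const_mx 1%N) by rewrite -topS.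
    by apply/rowP => j; rewrite !mxE ord1.
  move=> x [i /= i1]; have -> : i = 1%N by lia.
  move=> xi; have : [set unit_row 1 1 *+ 1] x by rewrite -topS.
  by move=> ->; apply/rowP => j; rewrite !mxE ord1.
have [km|mk] := ltnP k m.
  rewrite Theta_low//; last by lia.
  apply: eq_bigcupr => i /= i1k; rewrite /Theta0 ifF//.
  by lia.
rewrite Theta_high//.
rewrite (_ : [set i | (1 <= i <= m)%N] = [set i | (1 <= i <= m - 1)%N] `|` [set m]).
  rewrite bigcup_setU bigcup_set1 topS; congr (_ `|` _).
  apply: eq_bigcupr => i /= i1k; rewrite /Theta0 ifF; last by lia.
  by rewrite (@Theta_stable k) ?(@Theta_stable m)//; lia.
apply/seteqP; split=> i /=; lia.
Qed.

Lemma fsbig_bigcup_nat (R : nmodType) (T : choiceType) (A : nat -> set T)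
    (F : T -> R) (N : nat) :
  (forall i, finite_set (A i)) ->
  (forall i j x, (1 <= i)%N -> (i < j)%N -> (j <= N)%N -> A i x -> A j x -> False) ->
  \sum_(x \in \bigcup_(i in [set i | (1 <= i <= N)%N]) A i) F x =
  \sum_(1 <= i < N.+1) \sum_(x \in A i) F x.
Proof.
move=> fA; elim: N => [|N IH] dA.
  rewrite big_nil (_ : bigcup _ _ = set0) ?fsbig_set0//.
  by apply/seteqP; split=> // x [i /=]; lia.
rewrite big_nat_recr//= -IH; last first.
  by move=> i j x i1 ij jN; apply: dA => //; lia.
rewrite (_ : [set i | (1 <= i <= N.+1)%N] = [set i | (1 <= i <= N)%N] `|` [set N.+1]).
  rewrite bigcup_setU bigcup_set1 fsbigU0//.
  - apply: bigcup_finite => //.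
    by apply: (sub_finite_set _ (finite_II N.+1)) => i /= /andP[].
  - move=> x [[i /= /andP[i1 iN] Aix] ANx].
    by apply: (dA i N.+1 x) => //; lia.
apply/seteqP; split=> i /=; lia.
Qed.

Section weights.
Variables (R : realType) (k n0 : nat) (alpha s : R) (lam : nat -> nat -> R).
Notation L n := (\sum_(1 <= i < k.+1) lam n i).
Notation term := (GFBP_term k n0 alpha lam s).

(** The indices 0 and m always belong to Lambda. *)
Lemma prod_LambdaE m (x : 'rV[nat]_m) (F : nat -> R) :
  \prod_(j in Lambda x) F j =
  (\prod_(j < m) if ~~ ((0 < j)%N && (x ord0 j == 0%N)) then F j else 1) * F m.
Proof.
rewrite big_mkcond big_ord_recr/=.
congr (_ * _).
  apply: eq_bigr => j _; congr (if _ then _ else _).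
  rewrite !inE andbT; congr (~~ _).
  apply/imsetP/idP => [[l]|j0].
    rewrite inE => /andP[/andP[l0 _] xl] /(congr1 val)/= jl.
    by rewrite (_ : j = l) ?l0//; apply: val_inj.
  exists j; last exact: val_inj.
  move: j0 => /andP[j0 xj]; rewrite inE /= xj andbT.
  by have := ltn_ord j; lia.
rewrite ifT// !inE andbT; apply/imsetP => -[l _ /(congr1 val)/= ml].
by have := ltn_ord l; rewrite -ml ltnn.
Qed.

(** The jump brings its own rate and the denominator of the state that it
    reaches; column m - i holds the nonzero entry i, so that index m - i, the
    last one in Lambda of x, stays in Lambda of the longer tuple. *)
Lemma GFBP_term_append m i (x : 'rV[nat]_(m - i)) : (0 < i <= m)%N ->
  term (append_jump m i x) =
  lam (n0 + (m - i))%N i * term x / (s `^ alpha + L (n0 + m)%N).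
Proof.
move=> /andP[i0 im]; pose p := (m - i)%N.
have pm : (p < m)%N by rewrite /p; lia.
(* the products over the m columns split at column p, where the jump sits *)
have split_at (F : 'I_m -> R) (c : R) (G : 'I_p -> R) :
    (forall j : 'I_p, F (widen_ord (ltnW pm) j) = G j) -> F (Ordinal pm) = c ->
    (forall j : 'I_m, (p < j)%N -> F j = 1) ->
    \prod_(j < m) F j = (\prod_(j < p) G j) * c.
  move=> FG Fc F1.
  pose F' (j : nat) := if insub j is Some j' then F j' else 1.
  have FF' (j : 'I_m) : F j = F' j by rewrite /F' valK.
  under eq_bigr do rewrite FF'.
  rewrite -(big_mkord xpredT F') (@big_cat_nat _ _ _ p)//=; last exact: ltnW.
  congr (_ * _).
    rewrite big_mkord; apply: eq_bigr => j _; rewrite -FG FF' //.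
  rewrite big_ltn// -[F' p]/(F' (Ordinal pm)) -FF' Fc big_nat big1 ?mulr1// => j.
  by move=> /andP[pj jm]; rewrite -[j]/(val (Ordinal jm)) -FF' F1.
pose D (j : nat) := s `^ alpha + L (n0 + j)%N.
rewrite /GFBP_term !(prod_LambdaE _ D).
rewrite (split_at _ (lam (n0 + p)%N i) (fun j => rate0 lam (n0 + j) (x ord0 j))); first last.
- by move=> j pj; rewrite (append_jump_ge _ _ (ltnW pj)) (gtn_eqF pj) mul0n.
- by rewrite append_jump_ge//= eqxx mul1n /rate0 gtn_eqF.
- move=> j /=; rewrite (@append_jump_lt _ _ _ _ (widen_ord (ltnW pm) j) (ltn_ord j))//.
  by congr (rate0 _ _ (x _ _)); apply: val_inj.
rewrite (split_at _ (D p) (fun j => if ~~ ((0 < j)%N && (x ord0 j == 0%N)) then D j else 1)); first last.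
- move=> j pj; rewrite (append_jump_ge _ _ (ltnW pj)) (gtn_eqF pj) mul0n eqxx andbT.
  by rewrite (leq_ltn_trans (leq0n p) pj).
- by rewrite append_jump_ge//= eqxx mul1n gtn_eqF// andbF.
- move=> j /=; rewrite (@append_jump_lt _ _ _ _ (widen_ord (ltnW pm) j) (ltn_ord j))//.
  by rewrite (_ : Ordinal _ = j)//; apply: val_inj.
rewrite -/(D p) -/(D m) !invfM; ring.
Qed.

Definition GFBP_sum (m : nat) : R := \sum_(x \in Theta0 k m) term x.

Lemma GFBP_sum0 : GFBP_sum 0 = s `^ (alpha - 1) / (s `^ alpha + L n0).
Proof.
rewrite /GFBP_sum (_ : Theta0 k 0 = [set 0]).
  rewrite fsbig_set1 /GFBP_term.
  rewrite (prod_LambdaE _ (fun j => s `^ alpha + L (n0 + j)%N)).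
  by rewrite !big_ord0 mulr1 mul1r addn0.
by apply/seteqP; split=> x _ //=; rewrite thinmx0.
Qed.

Lemma GFBP_sum_rec m : (0 < k)%N -> (0 < m)%N ->
  GFBP_sum m = (\sum_(1 <= i < (minn m k).+1) lam (n0 + (m - i))%N i * GFBP_sum (m - i))
    / (s `^ alpha + L (n0 + m)%N).
Proof.
move=> k0 m0; rewrite /GFBP_sum [in LHS]/Theta0 ifF; last by lia.
rewrite Theta_append// fsbig_bigcup_nat; last 2 first.
- by move=> i; apply: finite_image; exact: Theta0_finite.
- move=> i j _ i1 ij jN [x _ <-] [y _] /esym; apply: append_jump_neq => //; lia.
rewrite mulr_suml; apply: eq_big_nat => i i1.
rewrite fsbig_image; last first.
  by move=> x y _ _; apply: append_jump_inj; lia.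
rewrite mulr_fsumr mulr_fsuml; apply: eq_fsbigr => x _.
by rewrite GFBP_term_append//; lia.
Qed.

End weights.

(** * The birth process *)

Section bounded_measurable.
Variables (R : realType).
Notation mu := (@lebesgue_measure R).

Definition bounded_measurable (f : R -> R) : Prop :=
  measurable_fun (`[0, +oo[%classic : set R) f /\
  exists M, forall t, 0 <= t -> `|f t| <= M.

Lemma integrable_damped s (f : R -> R) : 0 < s -> bounded_measurable f ->
  mu.-integrable setT (EFin \o damped s f).
Proof. by move=> s0 [mf [M fM]]; exact: (integrable_damped_bounded s0 mf fM). Qed.

Lemma bounded_measurable_lincomb (r : seq nat) (c : nat -> R) (f : nat -> R -> R) :
  (forall i, i \in r -> bounded_measurable (f i)) ->
  bounded_measurable (fun t => \sum_(i <- r) c i * f i t).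
Proof.
elim: r => [_|i r IH fr].
  under eq_fun do rewrite big_nil.
  by split=> //; exists 0 => t _; rewrite normr0.
have [mr [M rM]] := IH (fun j jr => fr j (mem_behead (s := i :: r) jr)).
have [mi [N iN]] := fr i (mem_head _ _).
under eq_fun do rewrite big_cons.
split; first by apply: measurable_funD => //; exact: measurable_funM.
exists (`|c i| * N + M) => t t0.
rewrite (le_trans (ler_normD _ _))// lerD ?rM// normrM ler_wpM2l//.
exact: iN.
Qed.

Lemma Rintegral_damped_lincomb s (r : seq nat) (c : nat -> R) (f : nat -> R -> R) :
  0 < s -> (forall i, i \in r -> bounded_measurable (f i)) ->
  \int[mu]_t damped s (fun t => \sum_(i <- r) c i * f i t) t =
  \sum_(i <- r) c i * \int[mu]_t damped s (f i) t.
Proof.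
move=> s0; elim: r => [_|i r IH fr].
  rewrite big_nil -[RHS](mul0r (\int[mu]_t damped s (cst 0) t)) -RintegralZl//.
    apply: eq_Rintegral => t _; rewrite mul0r; have [t0|t0] := ltP t 0.
      by rewrite damped_lt0.
    by rewrite dampedE// big_nil mulr0.
  apply: integrable_damped => //; split => //; exists 0 => t _.
  by rewrite normr0.
have fr' j : j \in r -> bounded_measurable (f j).
  by move=> jr; apply: fr; rewrite inE jr orbT.
have ir := integrable_damped s0 (bounded_measurable_lincomb c fr').
have ii := integrable_damped s0 (fr i (mem_head _ _)).
rewrite big_cons -IH// -RintegralZl// -RintegralD//; last first.
  exact: (integrableZl measurableT (c i) ii).
apply: eq_Rintegral => t _; have [t0|t0] := ltP t 0.
  by rewrite !damped_lt0// mulr0 addr0.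
by rewrite !dampedE// big_cons mulrDr mulrCA.
Qed.

End bounded_measurable.

Section birth_process.
Variables (R : realType) (k n0 : nat) (alpha : R) (lam : nat -> nat -> R).
Variables (d : measure_display) (T : measurableType d) (P : probability T R).
Variables (X : R -> T -> option nat).
Hypotheses (halpha0 : 0 < alpha) (halpha1 : alpha <= 1).
Hypothesis (hlam : forall n i : nat, (n0 <= n)%N -> (1 <= i <= k)%N -> 0 < lam n i).
Hypothesis (hX : is_GFBP k n0 alpha lam P X).
Notation mu := (@lebesgue_measure R).
Notation p m := (state_prob P X (n0 + m)%N).
Notation L n := (\sum_(1 <= i < k.+1) lam n i).

Lemma state_prob_bounded n t : 0 <= t -> `|state_prob P X n t| <= 1.
Proof.
move=> t0; have mX := GFBP_measurable hX n t0; rewrite /state_prob.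
rewrite ger0_norm ?fine_ge0// -lee_fin fineK ?fin_num_measure//.
exact: probability_le1.
Qed.

Lemma bounded_measurable_state_prob m : bounded_measurable (p m).
Proof.
split.
  by apply: abs_continuous_measurable; apply: (GFBP_abs_continuous hX); exact: leq_addr.
by exists 1 => t; exact: state_prob_bounded.
Qed.

(** Index 0 stands for the loss term, so that the right-hand side of the
    equation is one linear combination. *)
Definition flow_coef (m i : nat) : R :=
  if i == 0%N then - L (n0 + m)%N else lam (n0 + (m - i))%N i.

Definition flow (m : nat) (t : R) : R :=
  \sum_(0 <= i < (minn m k).+1) flow_coef m i * p (m - i) t.

(** The terms with n - i < n0 vanish, which bounds i by m rather than by
    n0 + m. *)
Lemma caputo_state_prob m t : 0 < t -> caputo alpha (p m) t = flow m t.
Proof.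
move=> t0; rewrite (GFBP_equation hX (leq_addr _ _) t0) /flow.
rewrite (@big_ltn _ _ _ 0)// subn0 /flow_coef/=; congr (_ + _).
rewrite (@big_cat_nat _ _ _ (minn m k).+1)/=; [|by []|by lia].
rewrite [X in _ + X = _]big_nat [X in _ + X = _]big1 => [|i i1].
  by rewrite addr0; apply: eq_big_nat => -[//|i] i1; rewrite -addnBA//; lia.
by rewrite (GFBP_lt hX) ?mulr0 ?ltW//; lia.
Qed.

Lemma total_rate_ge0 m : 0 <= L (n0 + m)%N.
Proof.
rewrite big_nat sumr_ge0// => i ik; apply/ltW/hlam => //; exact: leq_addr.
Qed.

Lemma state_prob0 m : p m 0 = (m == 0%N)%:R.
Proof.
case: m => [|m]; first by rewrite addn0 (GFBP_init hX).
by rewrite (GFBP_init_gt hX)//; lia.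
Qed.

Variable s : R.
Hypothesis s0 : 0 < s.
Notation F m := (\int[mu]_t damped s (p m) t).

Lemma laplace_state_prob_rec m :
  F m * (s `^ alpha + L (n0 + m)%N) = s `^ (alpha - 1) * (m == 0%N)%:R +
    \sum_(1 <= i < (minn m k).+1) lam (n0 + (m - i))%N i * F (m - i)%N.
Proof.
have [mflow [N flowN]] : bounded_measurable (flow m).
  apply: bounded_measurable_lincomb => i _.
  exact: bounded_measurable_state_prob.
have := Rintegral_damped_caputo halpha0 halpha1 s0
  (GFBP_abs_continuous hX (leq_addr m n0))
  (state_prob_bounded _) mflow flowN (@caputo_state_prob m).
rewrite Rintegral_damped_lincomb//; last first.
  by move=> i _; exact: bounded_measurable_state_prob.
have SE : \sum_(1 <= i < (minn m k).+1) flow_coef m i * F (m - i)%N =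
    \sum_(1 <= i < (minn m k).+1) lam (n0 + (m - i))%N i * F (m - i)%N.
  by apply: eq_big_nat => -[].
rewrite state_prob0 (@big_ltn _ _ _ 0)// SE subn0 /flow_coef/= => E.
rewrite mulrDr [F m * s `^ _]mulrC.
rewrite -[s `^ alpha * _](subrK (s `^ (alpha - 1) * (m == 0%N)%:R)) -E; ring.
Qed.

Lemma laplace_state_probE m : (0 < k)%N -> F m = GFBP_sum k n0 alpha s lam m.
Proof.
move=> k0; elim/ltn_ind: m => m IH.
have D0 : s `^ alpha + L (n0 + m)%N != 0.
  by rewrite gt_eqF// ltr_wpDr ?total_rate_ge0// powR_gt0.
apply: (mulIf D0); rewrite laplace_state_prob_rec.
have [m0|m0] := posnP m.
  subst m; rewrite min0n big_geq// addr0 mulr1 GFBP_sum0 addn0 divfK//.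
  by rewrite addn0 in D0.
rewrite GFBP_sum_rec// divfK// mulr0 add0r.
by apply: eq_big_nat => i i1; rewrite IH//; lia.
Qed.

(** Integrability is what allows the passage from the real integral to the
    extended one. *)
Lemma laplace_state_prob m : (0 < k)%N ->
  laplace (p m) s = (GFBP_sum k n0 alpha s lam m)%:E.
Proof.
move=> k0; rewrite laplaceE -laplace_state_probE// /Rintegral fineK//.
apply: integrable_fin_num => //; apply: integrable_damped => //.
exact: bounded_measurable_state_prob.
Qed.

End birth_process.

Theorem proposition2p1 (R : realType) (k n0 : nat) (alpha : R)
    (lam : nat -> nat -> R) (d : measure_display) (T : measurableType d)
    (P : probability T R) (X : R -> T -> option nat)
    (hk : (1 <= k)%N) (halpha0 : 0 < alpha) (halpha1 : alpha <= 1)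
    (hlam : forall n i : nat, (n0 <= n)%N -> (1 <= i <= k)%N -> 0 < lam n i)
    (hX : is_GFBP k n0 alpha lam P X)
    (s : R) (hs : 0 < s) :
  laplace (state_prob P X n0) s
    = (s `^ (alpha - 1) / (s `^ alpha + \sum_(1 <= i < k.+1) lam n0 i))%:E
  /\
  forall m : nat, (1 <= m)%N ->
    laplace (state_prob P X (n0 + m)%N) s
    = (if (k <= m - 1)%N
       then \sum_(x \in Theta k m) GFBP_term k n0 alpha lam s x
       else \sum_(x \in Theta m m) GFBP_term k n0 alpha lam s x)%:E.
Proof.
have E m := laplace_state_prob halpha0 halpha1 hlam hX hs m hk.
split=> [|m m1]; first by rewrite -[n0 in LHS]addn0 E GFBP_sum0.
rewrite E /GFBP_sum /Theta0 ifF; last by lia.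
by case: ifPn => // km; rewrite Theta_stable//; lia.
Qed.
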